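(* Let $n,r,s\ge 1$ be integers and let $k$ be defined by $2k+1=(2r+1)(2s+1)$. For $1\le a\le r$, set $I_a=\{(a-1)(2s+1)+1,\dots,a(2s+1)\}$, and set $M=\{r(2s+1)+1,\dots,(r+1)(2s+1)\}$. Let $G_{2n+1}(2r+1,2s+1)$ be the simple graph with vertex set $$\{u_i,v_i: 1\le i\le 2k+1\}\cup\{Y_{a,j},Z_{a,j}: 1\le a\le r,\ 1\le j\le 2n+1\}\cup\{X_j: 1\le j\le 2n+1\}$$ and edge set consisting of - $u_iv_i$ for $1\le i\le 2k+1$; - for each $1\le a\le r$, $1\le j\le 2n+1$ and $i\in I_a$: the edges $Y_{a,j}u_i$, $Y_{a,j}v_{2k+2-i}$, $Z_{a,j}v_i$, $Z_{a,j}u_{2k+2-i}$; - for each $1\le j\le 2n+1$ and $i\in M$: the edges $X_ju_i$ and $X_jv_{2k+2-i}$. (This graph is tripartite and has $r+1$ components.) Then $\chi_{la}(G_{2n+1}(2r+1,2s+1))=3$.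
   Context: For a graph $G$ with $q$ edges, a local antimagic labeling is a bijection $f:E(G)\to\{1,2,\dots,q\}$ such that $f^+(u)\ne f^+(v)$ for every edge $uv\in E(G)$. Here $f^+(u)=\sum_{e\ni u} f(e)$ is the sum of the labels of the edges incident to $u$. The color number of $f$ is the number of distinct values of $f^+$. The local antimagic chromatic number $\chi_{la}(G)$ is the minimum color number over all local antimagic labelings of $G$. *)

(* Defs.v *)
From HB Require Import structures.
From mathcomp Require Import all_boot.

Set Implicit Arguments.
Unset Strict Implicit.
Unset Printing Implicit Defensive.

Record sgraph := SGraph {
  vertex :> finType;
  adj : rel vertex;
  adj_sym : symmetric adj;
  adj_irrefl : irreflexive adj
}.

Definition edges (G : sgraph) : {set {set G}} :=
  [set [set x; y] | x in [set: G], y in [set: G] & adj x y].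

Definition tripartite (G : sgraph) : Prop :=
  exists c : G -> 'I_3, forall x y : G, adj x y -> c x != c y.

Definition components (G : sgraph) : nat := n_comp (@adj G) predT.

(** A labeling is a function on all sets of vertices, of which only the values
    on [edges G] are ever used. *)

Definition fplus (G : sgraph) (f : {set G} -> nat) (u : G) : nat :=
  \sum_(e in edges G | u \in e) f e.

Definition local_antimagic (G : sgraph) (f : {set G} -> nat) : Prop :=
  [/\ {in edges G &, injective f},
      forall l : nat,
        (exists2 e, e \in edges G & f e = l) <-> (1 <= l <= #|edges G|)
    & forall u v : G, adj u v -> fplus f u <> fplus f v].

Definition color_number (G : sgraph) (f : {set G} -> nat) : nat :=
  size (undup (codom (fplus f))).

(** [is_chi_la G c] is the equation chi_la(G) = c. It is a relation because a
    graph with a component K_2 has no local antimagic labeling, so that the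
    minimum need not exist. *)
Definition is_chi_la (G : sgraph) (c : nat) : Prop :=
  (exists2 f : {set G} -> nat, local_antimagic f & color_number f = c)
  /\ (forall f : {set G} -> nat, local_antimagic f -> c <= color_number f).

(** Indices start at 0: [U i], [Y a j], ... stand for u_{i+1}, Y_{a+1,j+1}, ...
    The reflection i |-> 2k+2-i of {1, ..., 2k+1} becomes [rev_ord]. *)
Inductive Gvertex (n r k : nat) : Type :=
  | U of 'I_k.*2.+1
  | V of 'I_k.*2.+1
  | Y of 'I_r & 'I_n.*2.+1
  | Z of 'I_r & 'I_n.*2.+1
  | X of 'I_n.*2.+1.

Section GvertexFinite.
Variables n r k : nat.

Let code : Type :=
  ('I_k.*2.+1 + 'I_k.*2.+1
   + ('I_r * 'I_n.*2.+1 + 'I_r * 'I_n.*2.+1) + 'I_n.*2.+1)%type.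

Definition Gvertex_encode (x : Gvertex n r k) : code :=
  match x with
  | U i => inl (inl (inl i))
  | V i => inl (inl (inr i))
  | Y a j => inl (inr (inl (a, j)))
  | Z a j => inl (inr (inr (a, j)))
  | X j => inr j
  end.

Definition Gvertex_decode (c : code) : Gvertex n r k :=
  match c with
  | inl (inl (inl i)) => U n r i
  | inl (inl (inr i)) => V n r i
  | inl (inr (inl (a, j))) => Y k a j
  | inl (inr (inr (a, j))) => Z k a j
  | inr j => X r k j
  end.

Lemma Gvertex_encodeK : cancel Gvertex_encode Gvertex_decode.
Proof. by case. Qed.

HB.instance Definition _ := Finite.copy (Gvertex n r k) (can_type Gvertex_encodeK).
End GvertexFinite.

(** [block s b] is I_{b+1} for b < r, and [block s r] is M. *)
Definition block (s b i : nat) : bool := b * s.*2.+1 <= i < b.+1 * s.*2.+1.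

(** A vertex v_{2k+2-i} with i in I_a is a v_{i'} with 2k+2-i' in I_a. *)
Definition Garc (n r s k : nat) (x y : Gvertex n r k) : bool :=
  match x, y with
  | U i, V i' => i == i'
  | Y a _, U i => block s a i
  | Y a _, V i => block s a (rev_ord i)
  | Z a _, V i => block s a i
  | Z a _, U i => block s a (rev_ord i)
  | X _, U i => block s r i
  | X _, V i => block s r (rev_ord i)
  | _, _ => false
  end.

Definition Gadj (n r s k : nat) : rel (Gvertex n r k) :=
  fun x y => Garc s x y || Garc s y x.

Lemma Gadj_sym n r s k : symmetric (@Gadj n r s k).
Proof. by move=> x y; rewrite /Gadj orbC. Qed.

Lemma Gadj_irrefl n r s k : irreflexive (@Gadj n r s k).
Proof. by case. Qed.

(** This is G_{2n+1}(2r+1, 2s+1) when 2k+1 = (2r+1)(2s+1). *)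
Definition Ggraph (n r s k : nat) : sgraph :=
  SGraph (@Gadj_sym n r s k) (@Gadj_irrefl n r s k).

(* Main.v *)
Require Import Defs.
From mathcomp Require Import all_boot.
From mathcomp Require Import zify.

(* Put N = 2k+1, p = 2s+1 and number the hubs by 0 <= b <= 2r: Y_b for b < r, X
   for b = r, Z_(2r-b) for b > r. With indices from 0, u_i is joined to the hubs
   of the block b = i %/ p and v_i to those of the reflected block 2r - b.
   Cut {1, ..., N(4n+3)} into 4n+3 rows of N consecutive labels. Row 0 labels
   the edges u_i v_i, row j+1 the edges from the u_i to their j-th hub, and row
   4n+2-j the edges from the v_i to their j-th hub; rows are filled alternately
   downwards and upwards. Paired rows of opposite direction make all column
   sums at the u_i (resp. v_i) equal, and the labels of the two edges joining
   the j-th hub to u_i and to v_(N-1-i) always add up to 4(n+1)N + 1, so every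
   hub gets p(4(n+1)N + 1). The three sums are distinct, and three colors are
   needed because u_k, v_k and X_0 form a triangle. *)

Set Implicit Arguments.
Unset Strict Implicit.
Unset Printing Implicit Defensive.

(** * Counting components; three colors forced by a triangle *)

(** Being constant along edges, [h] is constant on components; having connected fibers, it separates
    their roots. So it restricts to a bijection from the roots onto ['I_m]. *)
Lemma n_comp_fibers (T : finType) (e : rel T) (m : nat) (h : T -> 'I_m) :
  connect_sym e -> (forall x y, e x y -> h x = h y) ->
  (forall x y, h x = h y -> connect e x y) -> (forall a, exists x, h x = a) ->
  n_comp e predT = m.
Proof.
move=> sym_e he hc hsurj.
have h_conn x y : connect e x y -> h x = h y.
  by case/connectP=> p + ->; elim: p x => //= z p IHp x /andP[/he-> /IHp].
have root_h x y : h x = h y -> root e x = root e y by move/hc/(rootP sym_e).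
rewrite /n_comp_mem -[RHS]card_ord.
rewrite -(@card_in_imset _ _ h [predI roots e & predT]).
  apply/eq_card=> a; rewrite !inE; apply/imsetP.
  have [x <-] := hsurj a; exists (root e x).
    by rewrite !inE roots_root.
  exact/h_conn/connect_root.
move=> x y; rewrite !inE !andbT => /eqP rx /eqP ry /root_h.
by rewrite rx ry.
Qed.

Lemma triangle_color_number (G : sgraph) (x y z : G) (f : {set G} -> nat) :
  adj x y -> adj y z -> adj x z -> local_antimagic f -> 3 <= color_number f.
Proof.
move=> xy yz xz [_ _ fP]; rewrite /color_number.
apply: (@uniq_leq_size _ [:: fplus f x; fplus f y; fplus f z]).
  rewrite /= !inE !negb_or.
  by rewrite (introN eqP (fP _ _ xy)) (introN eqP (fP _ _ yz)) (introN eqP (fP _ _ xz)).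
by move=> c; rewrite mem_undup !inE => /or3P[] /eqP ->; exact: codom_f.
Qed.

(** * Labelings obtained from an indexing of the edges *)

Section EdgeEnumeration.
Variables (G : sgraph) (K : finType) (E : K -> {set G}) (code : K -> nat).
Hypotheses (injE : injective E) (imE : edges G = E @: [set: K]).
Hypotheses (inj_code : injective code) (code_lt : forall x, code x < #|K|).

(** A labeling takes any set of vertices. The sum inverts [E] without choosing a preimage: it has
    one term on an edge and none elsewhere. The successor makes labels start at 1. *)
Definition enum_labeling (e : {set G}) : nat := \sum_(x | E x == e) (code x).+1.

Lemma enum_labelingE x : enum_labeling (E x) = (code x).+1.
Proof. by apply: big_pred1 => y; rewrite /= (inj_eq injE). Qed.

Lemma fplus_enum_labeling u :
  fplus enum_labeling u = \sum_(x | u \in E x) (code x).+1.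
Proof.
rewrite /fplus imE.
transitivity (\sum_(e in E @: [set x | u \in E x]) enum_labeling e).
  apply: eq_bigl => e; apply/andP/imsetP => [[/imsetP[x _ ->] ux]|[x]].
    by exists x; rewrite ?inE.
  by rewrite inE => ux ->; rewrite imset_f ?inE.
rewrite big_imset /=; last by move=> x y _ _ /injE.
by apply: eq_big => x; rewrite ?inE // => _; exact: enum_labelingE.
Qed.

Lemma card_edges_enum : #|edges G| = #|K|.
Proof. by rewrite imE card_imset // cardsT. Qed.

Lemma enum_labeling_antimagic :
  (forall u v : G, adj u v -> fplus enum_labeling u <> fplus enum_labeling v) ->
  local_antimagic enum_labeling.
Proof.
move=> fP; split=> //.
  move=> e1 e2; rewrite imE => /imsetP[x _ ->] /imsetP[y _ ->].
  by rewrite !enum_labelingE => -[/inj_code ->].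
move=> l; rewrite card_edges_enum; split=> [[e]|/andP[l_gt0 lK]].
  by rewrite imE => /imsetP[x _ ->] <-; rewrite enum_labelingE code_lt.
have inj_o : injective (fun x => Ordinal (code_lt x)).
  by move=> x y [] /inj_code.
have lt_l : l.-1 < #|K| by rewrite prednK.
(* An injection between finite types of equal size is bijective; the edge labelled [l] is the
   preimage of [l.-1]. *)
have [g _ gK] := inj_card_bij inj_o (eq_leq (card_ord _)).
exists (E (g (Ordinal lt_l))); first by rewrite imE imset_f ?inE.
by rewrite enum_labelingE -[code _]/(val (Ordinal (code_lt _))) gK /= prednK.
Qed.
End EdgeEnumeration.

(** * Blocks as quotients, and two elementary sums *)

Lemma divn_block s b i : block s b i = (i %/ s.*2.+1 == b).
Proof.
rewrite /block -leq_divRL // -ltn_divLR //.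
by rewrite ltnS eqn_leq andbC.
Qed.

Lemma card_block (N p q b : nat) : N = q * p -> 0 < p -> b < q ->
  #|[pred i : 'I_N | i %/ p == b]| = p.
Proof.
move=> Nqp p0 bq.
have lt_bp (t : 'I_p) : b * p + t < N.
  by have := ltn_ord t; nia.
have inj_t : injective (fun t => Ordinal (lt_bp t)).
  by move=> t u [] /addnI /val_inj.
rewrite -[RHS]card_ord -(card_imset _ inj_t); apply/eq_card=> i.
rewrite inE; apply/eqP/imsetP=> [ib|[t _ ->] /=].
  exists (Ordinal (ltn_pmod i p0)) => //; apply: val_inj.
  by rewrite /= -ib -divn_eq.
by rewrite divnMDl // divn_small ?addn0.
Qed.

Lemma sum_alternating n a b :
  \sum_(j < n.*2.+1) (if odd j then a else b) = n * (a + b) + b.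
Proof.
elim: n => [|n IHn]; first by rewrite big_ord1.
by rewrite !doubleS 2!big_ord_recr /= IHn odd_double /=; lia.
Qed.

Lemma sum_ord_double n : \sum_(j < n.*2.+1) j = n.*2.+1 * n.
Proof.
elim: n => [|n IHn]; first by rewrite big_ord1.
by rewrite !doubleS 2!big_ord_recr /= IHn; nia.
Qed.

(** * Uniform indexing of the hubs and edges; the labeling *)

Section Labeling.
Variables (n r s k : nat).
Hypothesis hk : k.*2.+1 = r.*2.+1 * s.*2.+1.
Local Notation N := k.*2.+1.
Local Notation m := n.*2.+1.
Local Notation p := s.*2.+1.
Local Notation G := (Ggraph n r s k).
Local Notation K := ('I_N + ('I_N * 'I_m + 'I_N * 'I_m))%type.

(** The first [insub] succeeds for [b < r], the second for [b > r], and [b = r] is left for [X].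
    Values [b > r.*2] are junk because the subtraction truncates. *)
Definition hub (b : nat) (j : 'I_m) : G :=
  if insub b is Some a then Y k a j
  else if insub (r.*2 - b) is Some a then Z k a j else X r k j.

Definition edge_of (x : K) : {set G} :=
  match x with
  | inl i => [set (U n r i : G); (V n r i : G)]
  | inr (inl (i, j)) => [set hub (i %/ p) j; (U n r i : G)]
  | inr (inr (i, j)) => [set hub (rev_ord i %/ p) j; (V n r i : G)]
  end.

Definition zigzag (j : 'I_m) (i : 'I_N) : 'I_N := if odd j then i else rev_ord i.

(** Quotient by [N] is the row, remainder the place in it. Both edge families use the same
    [zigzag j], so that at each hub the places of the edges to u_i and v_(N-1-i) add up to
    [N.-1]. *)
Definition code (x : K) : nat :=
  match x with
  | inl i => i
  | inr (inl (i, j)) => j.+1 * N + zigzag j i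
  | inr (inr (i, j)) => (n.*2.+1.*2 - j) * N + zigzag j i
  end.

Lemma card_index : #|{: K}| = (n.*2.+1.*2.+1) * N.
Proof. by rewrite !card_sum !card_prod !card_ord; nia. Qed.

Lemma code_lt x : code x < #|{: K}|.
Proof.
rewrite card_index; case: x => [i|[[i j]|[i j]]] /=; first by have := ltn_ord i; nia.
  by have := ltn_ord j; have := ltn_ord (zigzag j i); nia.
by have := ltn_ord j; have := ltn_ord (zigzag j i); nia.
Qed.

Lemma inj_zigzag j : injective (zigzag j).
Proof. by rewrite /zigzag; case: odd => // i i' /rev_ord_inj. Qed.

Lemma divn_code (x : nat) (i : 'I_N) : (x * N + i) %/ N = x.
Proof. by rewrite divnMDl // divn_small ?addn0. Qed.

(** The three families occupy row 0, rows 1 to 2n+1 and rows 2n+2 to 4n+2, which are disjoint;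
    within a row [zigzag j] is injective. *)
Lemma inj_code : injective code.
Proof.
have rowI (a b : nat) (i i' : 'I_N) : a * N + i = b * N + i' -> a = b /\ i = i'.
  move=> e; have ab : a = b by rewrite -(divn_code a i) e divn_code.
  by split=> //; move: e; rewrite ab => /addnI /val_inj.
move=> [i|[[i j]|[i j]]] [i'|[[i' j']|[i' j']]] /=.
- by move/val_inj ->.
- by rewrite -[nat_of_ord i]/(0 * N + i) => /rowI[].
- rewrite -[nat_of_ord i]/(0 * N + i) => /rowI[]; have := ltn_ord j'; lia.
- by rewrite -[nat_of_ord i']/(0 * N + i') => /rowI[].
- by case/rowI=> -[] /val_inj <- /inj_zigzag ->.
- case/rowI; have := ltn_ord j; have := ltn_ord j'; lia.
- rewrite -[nat_of_ord i']/(0 * N + i') => /rowI[]; have := ltn_ord j; lia.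
- case/rowI; have := ltn_ord j; have := ltn_ord j'; lia.
- case/rowI=> e; have {e}/val_inj <- : j = j' :> nat.
    by have := ltn_ord j; have := ltn_ord j'; lia.
  by move/inj_zigzag ->.
Qed.

Lemma block_index_le (i : 'I_N) : i %/ p <= r.*2.
Proof. by rewrite -ltnS ltn_divLR // -hk. Qed.

Lemma rev_block (i : 'I_N) : rev_ord i %/ p = r.*2 - i %/ p.
Proof.
have p0 : 0 < p by [].
have le_b := block_index_le i; rewrite /=.
(* With i = xp + t, the reflection N-1-i equals (2r-x)p + (p-1-t). *)
have -> : N - i.+1 = (r.*2 - i %/ p) * p + (p.-1 - i %% p).
  have := divn_eq i p; have := ltn_pmod i p0; move: (subnKC le_b) hk.
  move: (r.*2 - i %/ p) => d; move: (i %/ p) (i %% p) => x t <-.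
  by rewrite mulSn mulnDl; move: (x * _) (d * _) => y z; lia.
by rewrite divnMDl // [X in _ + X]divn_small ?addn0 // ltnS leq_subr.
Qed.

(** * Vertices and adjacency in terms of hubs *)

(** The index of the hubs that the vertex is joined to, or of the hub itself. It recovers [b] from
    [hub b j], and up to the reflection of b to 2r-b it is invariant along edges. *)
Definition block_of (x : G) : nat :=
  match (x : Gvertex n r k) with
  | U i => i %/ p
  | V i => rev_ord i %/ p
  | Y a _ => a
  | Z a _ => r.*2 - a
  | X _ => r
  end.

Lemma block_of_hub b j : b <= r.*2 -> block_of (hub b j) = b.
Proof.
move=> le_b; rewrite /hub; case: insubP => [a _ <- //|/= nb].
by case: insubP => [a _ /= e|/= nb'] /=; lia.
Qed.

Lemma eq_hub b b' j j' : b <= r.*2 -> b' <= r.*2 ->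
  (hub b j == hub b' j') = (b == b') && (j == j').
Proof.
move=> le_b le_b'; apply/eqP/andP=> [e|[/eqP-> /eqP-> //]].
have eb : b = b' by rewrite -(block_of_hub j le_b) e block_of_hub.
split; first exact/eqP.
move: e; rewrite -eb /hub.
by case: insubP => [a _ _ [->]|_] //; case: insubP => [a _ _ [->]|_ [->]].
Qed.

Lemma hub_eqU b j i : (hub b j == (U n r i : G)) = false.
Proof. by apply/eqP; rewrite /hub; do 2?case: insubP. Qed.

Lemma hub_eqV b j i : (hub b j == (V n r i : G)) = false.
Proof. by apply/eqP; rewrite /hub; do 2?case: insubP. Qed.

Lemma eqUU i i' : ((U n r i : G) == (U n r i' : G)) = (i == i').
Proof. by apply/eqP/eqP=> [[]|->]. Qed.

Lemma eqVV i i' : ((V n r i : G) == (V n r i' : G)) = (i == i').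
Proof. by apply/eqP/eqP=> [[]|->]. Qed.

Lemma eqUV i i' : ((U n r i : G) == (V n r i' : G)) = false.
Proof. by apply/eqP. Qed.

(** Merges [Y], [Z] and [X] into one case, so that adjacency needs only three kinds of vertices. *)
Variant vertex_spec : G -> Prop :=
  | VertexU i : vertex_spec (U n r i)
  | VertexV i : vertex_spec (V n r i)
  | VertexHub b j of b <= r.*2 : vertex_spec (hub b j).

Lemma vertexP x : vertex_spec x.
Proof.
case: x => [i|i|a j|a j|j]; [by constructor | by constructor | ..].
- have -> : Y k a j = hub a j by rewrite /hub valK.
  by constructor; have := ltn_ord a; lia.
- have -> : Z k a j = hub (r.*2 - a) j.
    rewrite /hub insubN; last by have := ltn_ord a; lia.
    by rewrite subKn ?valK //; have := ltn_ord a; lia.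
  by constructor; lia.
- have -> : X r k j = hub r j by rewrite /hub !insubN //; lia.
  by constructor; lia.
Qed.

Lemma adjUV i i' : @adj G (U n r i) (V n r i') = (i == i').
Proof. by rewrite /= /Gadj /= orbF. Qed.

Lemma adj_hubU b j i : b <= r.*2 -> @adj G (hub b j) (U n r i) = (i %/ p == b).
Proof.
move=> le_b; rewrite /= /Gadj /hub; case: insubP => [a _ <-|nb].
  by rewrite /= divn_block orbF.
have le_i := block_index_le i.
case: insubP => [a _ /= e|nb'] /=; rewrite orbF divn_block -/(rev_ord i).
  by rewrite rev_block e; lia.
by apply/eqP/eqP; lia.
Qed.

Lemma adj_hubV b j i : b <= r.*2 ->
  @adj G (hub b j) (V n r i) = (rev_ord i %/ p == b).
Proof.
move=> le_b; rewrite /= /Gadj /hub; case: insubP => [a _ <-|nb].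
  by rewrite /= divn_block orbF.
have le_i := block_index_le i.
case: insubP => [a _ /= e|nb'] /=; rewrite orbF divn_block.
  by rewrite rev_block e; lia.
by apply/eqP/eqP; lia.
Qed.

Lemma adj_hub_hub b b' j j' : @adj G (hub b j) (hub b' j') = false.
Proof. by rewrite /= /Gadj /hub; do 4?case: insubP. Qed.

Let eqE := (hub_eqU, hub_eqV, eqUV, eqUU, eqVV, eqxx, orbT, orbF).

(** * Incidence, and the indexing of the edge set *)

Lemma mem_edge_ofU i x : ((U n r i : G) \in edge_of x) =
  match x with inl i' | inr (inl (i', _)) => i == i' | _ => false end.
Proof.
case: x => [i'|[[i' j]|[i' j]]]; rewrite !inE.
- by rewrite !eqE.
- by rewrite eq_sym !eqE.
- by rewrite eq_sym !eqE.
Qed.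

Lemma mem_edge_ofV i x : ((V n r i : G) \in edge_of x) =
  match x with inl i' | inr (inr (i', _)) => i == i' | _ => false end.
Proof.
case: x => [i'|[[i' j]|[i' j]]]; rewrite !inE.
- by rewrite eq_sym !eqE.
- by rewrite eq_sym !eqE.
- by rewrite eq_sym !eqE.
Qed.

Lemma mem_edge_of_hub b j x : b <= r.*2 -> (hub b j \in edge_of x) =
  match x with
  | inl _ => false
  | inr (inl (i, j')) => (b == i %/ p) && (j == j')
  | inr (inr (i, j')) => (b == rev_ord i %/ p) && (j == j')
  end.
Proof.
move=> le_b; case: x => [i'|[[i' j']|[i' j']]]; rewrite !inE !eqE //.
  by rewrite eq_hub ?block_index_le.
by rewrite eq_hub ?block_index_le.
Qed.

(** Testing one endpoint for membership separates the families and recovers [i]; testing the hub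
    then recovers [j]. *)
Lemma inj_edge_of : injective edge_of.
Proof.
move=> x y exy; have mem u : (u \in edge_of x) = (u \in edge_of y) by rewrite exy.
case: x y mem {exy} => [i|[[i j]|[i j]]] [i'|[[i' j']|[i' j']]] mem.
- by have := mem (U n r i); rewrite !mem_edge_ofU eqxx => /esym/eqP ->.
- by have := mem (V n r i); rewrite !mem_edge_ofV eqxx.
- by have := mem (U n r i); rewrite !mem_edge_ofU eqxx.
- by have := mem (V n r i'); rewrite !mem_edge_ofV eqxx.
- have := mem (U n r i); rewrite !mem_edge_ofU eqxx => /esym/eqP ei.
  have := mem (hub (i %/ p) j).
  by rewrite !mem_edge_of_hub ?block_index_le // ei !eqxx => /esym/eqP ->.
- by have := mem (U n r i); rewrite !mem_edge_ofU eqxx.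
- by have := mem (U n r i'); rewrite !mem_edge_ofU eqxx.
- by have := mem (U n r i'); rewrite !mem_edge_ofU eqxx.
- have := mem (V n r i); rewrite !mem_edge_ofV eqxx => /esym/eqP ei.
  have := mem (hub (rev_ord i %/ p) j).
  by rewrite !mem_edge_of_hub ?block_index_le // ei !eqxx => /esym/eqP ->.
Qed.

Lemma adj_edge_of x y : @adj G x y -> exists z, [set x; y] = edge_of z.
Proof.
case: (vertexP x) (vertexP y) => [i|i|b j le_b] [i'|i'|b' j' le_b'] //.
- by rewrite adjUV => /eqP <-; exists (inl i).
- rewrite adj_sym adj_hubU // => /eqP <-.
  by exists (inr (inl (i, j'))); rewrite setUC.
- by rewrite adj_sym adjUV => /eqP <-; exists (inl i'); rewrite setUC.
- rewrite adj_sym adj_hubV // => /eqP <-.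
  by exists (inr (inr (i, j'))); rewrite setUC.
- by rewrite adj_hubU // => /eqP <-; exists (inr (inl (i', j))).
- by rewrite adj_hubV // => /eqP <-; exists (inr (inr (i', j))).
- by rewrite adj_hub_hub.
Qed.

Lemma edges_edge_of : edges G = edge_of @: [set: K].
Proof.
have edge_adj (x y : G) : adj x y -> [set x; y] \in edges G.
  by move=> xy; apply/imset2P; exists x y; rewrite ?inE.
apply/setP=> e; apply/idP/imsetP=> [/imset2P[x y _]|[z _ ->]].
  by rewrite inE => /andP[_ /adj_edge_of[z ez]] ->; exists z.
case: z => [i|[[i j]|[i j]]]; apply: edge_adj.
- by rewrite adjUV.
- by rewrite adj_hubU ?block_index_le.
- by rewrite adj_hubV ?block_index_le.
Qed.

(** * Components and tripartiteness *)

Lemma adj_block x y : @adj G x y ->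
  block_of x = block_of y \/ block_of x = r.*2 - block_of y.
Proof.
case: (vertexP x) (vertexP y) => [i|i|b j le_b] [i'|i'|b' j' le_b'] //.
- rewrite adjUV => /eqP <-; right.
  by rewrite /= -/(rev_ord i) rev_block subKn ?block_index_le.
- by rewrite adj_sym adj_hubU // block_of_hub // => /eqP <-; left.
- by rewrite adj_sym adjUV => /eqP <-; right; rewrite /= -/(rev_ord i') rev_block.
- by rewrite adj_sym adj_hubV // block_of_hub // => /eqP <-; left.
- by rewrite adj_hubU // block_of_hub // => /eqP <-; left.
- by rewrite adj_hubV // block_of_hub // => /eqP <-; left.
- by rewrite adj_hub_hub.
Qed.

Lemma block_nonempty b : b <= r.*2 -> exists i : 'I_N, i %/ p = b.
Proof.
move=> le_b; have lt_bp : b * p < N by rewrite hk ltn_mul2r ltnS.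
by exists (Ordinal lt_bp); rewrite /= mulnK.
Qed.

Lemma Ggraph_connect_sym : connect_sym (@adj G).
Proof. exact/sym_connect_sym/adj_sym. Qed.

Lemma block_of_le x : block_of x <= r.*2.
Proof.
case: (vertexP x) => [i|i|b j le_b]; rewrite ?block_of_hub //.
  exact: block_index_le.
exact: (block_index_le (rev_ord i)).
Qed.

Lemma connect_hub x : connect (@adj G) x (hub (block_of x) ord0).
Proof.
case: (vertexP x) => [i|i|b j le_b].
- rewrite Ggraph_connect_sym connect1 // adj_hubU //; exact: block_index_le.
- rewrite Ggraph_connect_sym connect1 // adj_hubV //; exact: (block_index_le (rev_ord i)).
- rewrite block_of_hub //; have [i ib] := block_nonempty le_b.
  apply: (@connect_trans _ _ (U n r i)).
    by rewrite connect1 // adj_hubU // ib.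
  by rewrite Ggraph_connect_sym connect1 // adj_hubU // ib.
Qed.

Lemma connect_hub_rev b : b <= r.*2 ->
  connect (@adj G) (hub b ord0) (hub (r.*2 - b) ord0).
Proof.
move=> le_b; have [i ib] := block_nonempty le_b.
apply: (@connect_trans _ _ (U n r i)); first by rewrite connect1 // adj_hubU // ib.
apply: (@connect_trans _ _ (V n r i)); first by rewrite connect1 // adjUV.
by rewrite Ggraph_connect_sym connect1 // adj_hubV ?leq_subr // rev_block ib.
Qed.

Lemma components_Ggraph : components G = r.+1.
Proof.
(* The components are the classes of blocks {b, 2r-b}. The smaller element represents the class and
   is at most r, so [inord] never takes its default value. *)
pose h (x : G) : 'I_r.+1 := inord (minn (block_of x) (r.*2 - block_of x)).
have val_h x : h x = minn (block_of x) (r.*2 - block_of x) :> nat.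
  by rewrite inordK //; lia.
have conn_h x : connect (@adj G) x (hub (h x) ord0).
  apply: (connect_trans (connect_hub x)); rewrite val_h; case: leqP => _ //.
  exact/connect_hub_rev/block_of_le.
apply: (n_comp_fibers (h := h)) => [|x y xy|x y hxy|a].
- exact: Ggraph_connect_sym.
- apply: ord_inj; rewrite !val_h.
  by have := block_of_le x; have := block_of_le y; case: (adj_block xy) => ->; lia.
- by rewrite (connect_trans (conn_h x)) // hxy Ggraph_connect_sym.
- exists (hub a ord0); apply: ord_inj; have lt_a := ltn_ord a.
  by rewrite val_h block_of_hub; lia.
Qed.

Lemma tripartite_Ggraph : tripartite G.
Proof.
exists (fun x : G => match x : Gvertex n r k with
  | U _ => inord 0 | V _ => inord 1 | _ => inord 2 end).
by case=> [i|i|a j|a j|j] [i'|i'|a' j'|a' j'|j'] //= _; apply/eqP => /(congr1 val);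
   rewrite /= !inordK.
Qed.

(** * The vertex sums *)

Local Notation f := (enum_labeling edge_of code).

Lemma sum_index (P : pred K) (F : K -> nat) :
  \sum_(x | P x) F x = \sum_(i | P (inl i)) F (inl i)
    + (\sum_i \sum_(j | P (inr (inl (i, j)))) F (inr (inl (i, j)))
       + \sum_i \sum_(j | P (inr (inr (i, j)))) F (inr (inr (i, j)))).
Proof.
rewrite big_sumType big_sumType /=; congr (_ + (_ + _)).
  by rewrite pair_big_dep; apply: eq_big => [[]|[]].
by rewrite pair_big_dep; apply: eq_big => [[]|[]].
Qed.

(** The n odd rows pair with n even ones, each pair giving N-1; one even row is left over. Its
    [rev_ord i] is later cancelled by the [i] of row 0, which removes the dependence on the
    column. *)
Lemma zigzag_sum i : \sum_(j < m) zigzag j i = n * N.-1 + rev_ord i.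
Proof.
rewrite (eq_bigr (fun j : 'I_m => if odd j then (i : nat) else rev_ord i)).
  by rewrite sum_alternating; congr (_ * _ + _) => /=; have := ltn_ord i; lia.
by move=> j _; rewrite /zigzag; case: odd.
Qed.

Lemma zigzag_rev j i : zigzag j i + zigzag j (rev_ord i) = N.-1.
Proof. by rewrite /zigzag; have := ltn_ord i; case: odd => /=; lia. Qed.

Lemma fplus_labeling u : fplus f u = \sum_(x | u \in edge_of x) (code x).+1.
Proof. exact: fplus_enum_labeling inj_edge_of edges_edge_of _. Qed.

Lemma fplusU i :
  fplus f (U n r i : G) = N * 2 * n.+1 ^ 2 + n.+1.
Proof.
rewrite fplus_labeling sum_index.
rewrite (big_pred1 i) => [|i']; last by rewrite mem_edge_ofU eq_sym.
rewrite [X in _ + (_ + X)]big1 => [|i' _]; last first.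
  by rewrite big_pred0 // => j; rewrite mem_edge_ofU.
rewrite (bigD1 i) // [X in _ + (_ + X + _)]big1 => [|i' ne_i]; last first.
  by rewrite big_pred0 // => j; rewrite mem_edge_ofU eq_sym (negbTE ne_i).
rewrite (eq_bigl predT) => [|j]; last by rewrite mem_edge_ofU eqxx.
rewrite (eq_bigr (fun j : 'I_m => j * N + zigzag j i + N.+1)); last by move=> j _; rewrite /= mulSn; lia.
rewrite !big_split /= -big_distrl /= sum_ord_double zigzag_sum sum_nat_const card_ord /=.
by have := ltn_ord i; nia.
Qed.

Lemma fplusV i :
  fplus f (V n r i : G) = N * (6 * n ^ 2 + 8 * n + 3) + n.+1.
Proof.
rewrite fplus_labeling sum_index.
rewrite (big_pred1 i) => [|i']; last by rewrite mem_edge_ofV eq_sym.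
rewrite [X in _ + (X + _)]big1 => [|i' _]; last first.
  by rewrite big_pred0 // => j; rewrite mem_edge_ofV.
rewrite (bigD1 i) // [X in _ + (_ + (_ + X))]big1 => [|i' ne_i]; last first.
  by rewrite big_pred0 // => j; rewrite mem_edge_ofV eq_sym (negbTE ne_i).
rewrite (eq_bigl predT) => [|j]; last by rewrite mem_edge_ofV eqxx.
rewrite (eq_bigr (fun j : 'I_m => (m.*2 - j) * N + zigzag j i + 1)); last by move=> j _; rewrite addn1.
rewrite !big_split /= -big_distrl /= zigzag_sum sum_nat_const card_ord /=.
have -> : \sum_(j < m) (m.*2 - j) = m * (3 * n + 2).
  (* Adding the sum of the [j] removes the truncated subtraction: every term becomes [m.*2]. *)
  apply: (@addIn (\sum_(j < m) j)); rewrite -big_split /= sum_ord_double.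
  rewrite (eq_bigr (fun=> m.*2)) => [|j _]; last by have := ltn_ord j; lia.
  by rewrite sum_nat_const card_ord; nia.
by have := ltn_ord i; nia.
Qed.

Lemma fplus_hub b j : b <= r.*2 ->
  fplus f (hub b j) = p * (4 * n.+1 * N).+1.
Proof.
move=> le_b; rewrite fplus_labeling sum_index.
rewrite big_pred0 => [|i]; last by rewrite mem_edge_of_hub.
(* Reflecting the second sum pairs u_i with v_(N-1-i), which share their hubs. Each of the p pairs
   in block [b] contributes 4(n+1)N + 1. *)
rewrite [X in _ + (_ + X)](reindex_inj rev_ord_inj) -big_split.
rewrite (eq_bigr (fun i : 'I_N => if i %/ p == b then (4 * n.+1 * N).+1 else 0)).
  rewrite -big_mkcond sum_nat_const (eq_card (B := [pred i : 'I_N | i %/ p == b])) //.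
  by rewrite (card_block hk).
move=> i _; case: eqP => ib.
  rewrite (big_pred1 j) => [|j']; last by rewrite mem_edge_of_hub // ib eqxx eq_sym.
  rewrite (big_pred1 j) => [|j']; last first.
    by rewrite mem_edge_of_hub // rev_ordK ib eqxx eq_sym.
  by have := zigzag_rev j i; have := ltn_ord j => /=; nia.
have nb : (b == i %/ p) = false by apply/eqP=> /esym.
by rewrite !big_pred0 // => j'; rewrite mem_edge_of_hub // ?rev_ordK nb.
Qed.

(** * The three sums are distinct *)

Lemma fplusUV_neq i i' : fplus f (U n r i : G) <> fplus f (V n r i' : G).
Proof. by rewrite fplusU fplusV; nia. Qed.

(** With Q = 2(n+1)N the sums are (n+1)Q + (n+1) and 2pQ + p. If 2p <= n+1 the first is larger,
    since p < n+1; otherwise 2p >= n+2 and the second is larger, since Q >= n+1. *)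
Lemma fplusU_hub_neq i b j : b <= r.*2 -> fplus f (U n r i : G) <> fplus f (hub b j).
Proof.
move=> le_b; rewrite fplusU fplus_hub // => e.
have [le_w|lt_w] := leqP (2 * p) n.+1.
  have : 2 * p * (2 * n.+1 * N) <= n.+1 * (2 * n.+1 * N) by rewrite leq_mul2r le_w orbT.
  by move: e le_w; clear; nia.
have : n.+2 * (2 * n.+1 * N) <= 2 * p * (2 * n.+1 * N) by rewrite leq_mul2r lt_w orbT.
by move: e; clear; nia.
Qed.

(** The sums are NA + (n+1) and NB + p with A = 6n^2+8n+3 and B = 4p(n+1), and A differs from B. If
    A < B then n < p, so equality would need n+1 >= N + p > n+1; if A > B it would need p >= N +
    n+1, against p <= N. *)
Lemma fplusV_hub_neq i b j : b <= r.*2 -> fplus f (V n r i : G) <> fplus f (hub b j).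
Proof.
move=> le_b; rewrite fplusV fplus_hub // => e.
have le_pN : p <= N by rewrite hk leq_pmull.
(* the left-hand side is odd and the right-hand side even *)
have [lt_c|lt_c|] := ltngtP (6 * n ^ 2 + 8 * n + 3) (4 * p * n.+1); last by lia.
- have : N * (6 * n ^ 2 + 8 * n + 3).+1 <= N * (4 * p * n.+1) by rewrite leq_mul2l lt_c.
  have lt_np : n < p by move: lt_c; clear; nia.
  by move: e lt_np; clear; nia.
- have : N * (4 * p * n.+1).+1 <= N * (6 * n ^ 2 + 8 * n + 3) by rewrite leq_mul2l lt_c.
  by move: e le_pN; clear; nia.
Qed.

Lemma fplus_neq x y : @adj G x y -> fplus f x <> fplus f y.
Proof.
case: (vertexP x) (vertexP y) => [i|i|b j le_b] [i'|i'|b' j' le_b'] // xy.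
- exact: fplusUV_neq.
- exact: fplusU_hub_neq.
- exact/nesym/fplusUV_neq.
- exact: fplusV_hub_neq.
- exact/nesym/fplusU_hub_neq.
- exact/nesym/fplusV_hub_neq.
- by rewrite adj_hub_hub in xy.
Qed.

(** * The local antimagic chromatic number *)

Lemma color_number_ge3 (g : {set G} -> nat) : local_antimagic g -> 3 <= color_number g.
Proof.
(* The middle index is fixed by [rev_ord], so u_c and v_c have a common hub. *)
pose c := inord k : 'I_N.
have val_c : c = k :> nat by rewrite inordK //; lia.
have rev_c : rev_ord c = c by apply: ord_inj; rewrite /= val_c; lia.
have le_bc := block_index_le c.
apply: (@triangle_color_number G (hub (c %/ p) ord0) (U n r c) (V n r c)).
- by rewrite adj_hubU.
- by rewrite adjUV.
- by rewrite adj_hubV // rev_c.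
Qed.

Lemma chi_la_Ggraph : is_chi_la G 3.
Proof.
have f_antimagic : local_antimagic f.
  apply: enum_labeling_antimagic => //.
  - exact: inj_edge_of.
  - exact: edges_edge_of.
  - exact: inj_code.
  - exact: code_lt.
  - exact: fplus_neq.
split; last exact: color_number_ge3.
exists f => //; apply/eqP; rewrite eqn_leq color_number_ge3 // andbT.
pose i : 'I_N := ord0.
(* The sums depend only on the kind of vertex, so any representatives serve. *)
apply: (@uniq_leq_size _ _ [:: fplus f (U n r i); fplus f (V n r i); fplus f (hub 0 ord0)]).
  exact: undup_uniq.
move=> c; rewrite mem_undup => /codomP[x ->]; rewrite !inE.
case: (vertexP x) => [i'|i'|b j le_b].
- by rewrite !fplusU eqxx.
- by rewrite !fplusV eqxx orbT.
- by rewrite !fplus_hub // eqxx !orbT.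
Qed.

End Labeling.

Theorem theorem3p2 (n r s k : nat) (hn : 1 <= n) (hr : 1 <= r) (hs : 1 <= s)
    (hk : k.*2.+1 = r.*2.+1 * s.*2.+1) :
  [/\ tripartite (Ggraph n r s k),
      components (Ggraph n r s k) = r.+1
    & is_chi_la (Ggraph n r s k) 3].
Proof.
split; first exact: tripartite_Ggraph.
  exact: components_Ggraph.
exact: chi_la_Ggraph.
Qed.
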